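(* Consider the FM85 (Flajolet–Martin, PCSA) sketch with $k$ bitmaps each of length $\ell$, for which $k_{max}=k\ell$. Let $\epsilon>0$, $\pi_0=1-e^{-\epsilon}$, $n_0=k\ell/(1-e^{-\epsilon})$, $v=\lceil-\log_2\pi_0\rceil$ and $\tilde\pi_0:=2^{-v}\in(\pi_0/2,\pi_0]$. If $n\ge n_0$, then the FM85 sketch run on streams of cardinality $n$ is $(\epsilon,\delta)$-DP with $\delta\le kv\exp(-\tilde\pi_0 n/k)$.
   Context: FM85 sketch: the state consists of $k$ bitmaps of length $\ell$, all bits initially $0$. Using a uniformly random hash function (the internal randomness $r$), each item $x$ is mapped to a pair $(B(x),G(x))$, with $B(x)$ uniform on $\{1,\dots,k\}$ and independently $G(x)\sim\mathrm{Geometric}(1/2)$ on $\{1,2,\dots\}$ (so $\Pr(G=j)=2^{-j}$), and inserting $x$ sets bit $G(x)$ of bitmap $B(x)$ to $1$; the state depends only on the set of hash values of the stream. Write $S_r(\mathcal D)$ for the state on data set $\mathcal D$ and $\mathcal D_{-i}=\mathcal D\setminus\{i\}$. For a state $s$, $\pi(s)$ is the probability that inserting a new, previously unseen item changes $s$. The sketch is $(\epsilon,\delta)$-DP on streams of cardinality $n$ if for every data set $\mathcal D$ of $n$ distinct items, every $i\in\mathcal D$ and every set $A$ of states: $\Pr_r(S_r(\mathcal D)\in A)\le e^{\epsilon}\Pr_r(S_r(\mathcal D_{-i})\in A)+\delta$ and $\Pr_r(S_r(\mathcal D_{-i})\in A)\le e^{\epsilon}\Pr_r(S_r(\mathcal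 D)\in A)+\delta$. *)

(* Defs.v *)
From HB Require Import structures.
From mathcomp Require Import all_boot all_order all_algebra finmap.
From mathcomp Require Import all_classical all_reals all_analysis.

Set Implicit Arguments.
Unset Strict Implicit.
Unset Printing Implicit Defensive.
Import Order.TTheory GRing.Theory Num.Theory.

Local Open Scope classical_set_scope.
Local Open Scope ring_scope.

(** A state is the [k] x [l] bit matrix whose row [b] is the bitmap [b].
    Bits are numbered from 1 in the sketch, so the column [j : 'I_l] holds the
    bit number [j.+1]. *)
Definition fm85_state (k l : nat) : Type := 'M[bool]_(k, l).

Definition fm85_init (k l : nat) : fm85_state k l := const_mx false.

(** The item has hash value [bg = (B, G)]. The bitmaps have no bit number [G]
    when [G > l], and the insertion then leaves the state unchanged. *)
Definition fm85_insert (k l : nat) (s : fm85_state k l) (bg : 'I_k * nat) :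
    fm85_state k l :=
  \matrix_(b < k, j < l) (s b j || ((b == bg.1) && (j.+1 == bg.2))).

Definition fm85_run (k l : nat) (X : Type) (h : X -> 'I_k * nat)
    (stream : seq X) : fm85_state k l :=
  foldl (fun s x => fm85_insert s (h x)) (fm85_init k l) stream.

Lemma fm85_runE (k l : nat) (X : Type) (h : X -> 'I_k * nat) (stream : seq X)
    (b : 'I_k) (j : 'I_l) :
  fm85_run l h stream b j = has (fun x => h x == (b, j.+1)) stream.
Proof.
suff runE s : foldl (fun s x => fm85_insert s (h x)) s stream b j =
    s b j || has (fun x => h x == (b, j.+1)) stream.
  by rewrite /fm85_run runE mxE.
elim: stream s => [|x t IH] s /=; first by rewrite orbF.
rewrite IH mxE -orbA; congr (_ || (_ || _)).
by case: (h x) => c g; rewrite xpair_eqE (eq_sym c) (eq_sym g).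
Qed.

(** The state depends only on the set of items of the stream: neither their
    order nor their multiplicities matter. *)
Lemma fm85_run_eq_mem (k l : nat) (X : eqType) (h : X -> 'I_k * nat)
    (s t : seq X) : s =i t -> fm85_run l h s = fm85_run l h t.
Proof.
by move=> st; apply/matrixP => b j; rewrite !fm85_runE; apply: eq_has_r.
Qed.

(** The sketch [S_r] of a data set; the choice of the enumeration of [D] is
    irrelevant by [fm85_run_eq_mem]. *)
Definition fm85_sketch (k l : nat) (X : choiceType) (T : Type)
    (h : X -> T -> 'I_k * nat) (D : {fset X}) (r : T) : fm85_state k l :=
  fm85_run l (h^~ r) (enum_fset D).

(** [h x r] is the pair [(B x, G x)] under the internal randomness [r].
    The hash values are discrete, hence every set of values is an event;
    [fm85_hash_G] makes [G x = 0] a null event. *)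
Record fm85_hash (d : measure_display) (T : measurableType d) (R : realType)
    (P : probability T R) (X : choiceType) (k : nat)
    (h : X -> T -> 'I_k * nat) : Prop := FM85Hash {
  fm85_hash_measurable : forall (x : X) (C : set ('I_k * nat)),
    measurable (h x @^-1` C);
  fm85_hash_B : forall (x : X) (b : 'I_k),
    P [set r | (h x r).1 = b] = (k%:R^-1)%:E;
  fm85_hash_G : forall (x : X) (j : nat), (0 < j)%N ->
    P [set r | (h x r).2 = j] = (2 ^- j)%:E;
  fm85_hash_BG_indep : forall (x : X) (b : 'I_k) (j : nat),
    P ([set r | (h x r).1 = b] `&` [set r | (h x r).2 = j]) =
    (P [set r | (h x r).1 = b] * P [set r | (h x r).2 = j])%E;
  fm85_hash_indep : forall (D : {fset X}) (C : X -> set ('I_k * nat)),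
    P (\bigcap_(x in [set` D]) (h x @^-1` C x)) =
    (\prod_(x <- D) P (h x @^-1` C x))%E
}.

(** [(eps, delta)]-differential privacy of a randomised sketch [S] on the
    streams of cardinality [n]. *)
Definition sketch_DP (d : measure_display) (T : measurableType d)
    (R : realType) (P : probability T R) (X : choiceType) (state : Type)
    (S : {fset X} -> T -> state) (n : nat) (eps delta : R) : Prop :=
  forall (D : {fset X}) (i : X), #|` D|%fset = n -> i \in D ->
  forall A : set state,
    (P (S D @^-1` A) <=
       (expR eps)%:E * P (S (D `\ i)%fset @^-1` A) + delta%:E)%E /\
    (P (S (D `\ i)%fset @^-1` A) <=
       (expR eps)%:E * P (S D @^-1` A) + delta%:E)%E.

(* Main.v *)
Require Import Defs.
From HB Require Import structures.
From mathcomp Require Import all_boot all_order all_algebra finmap.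
From mathcomp Require Import all_classical all_reals all_analysis.
From mathcomp Require Import perm ring lra zify.
Import Order.TTheory GRing.Theory Num.Theory.
Local Open Scope ring_scope.

Set Implicit Arguments.
Unset Strict Implicit.
Unset Printing Implicit Defensive.

(** Only the bit (B, G) hit by an item matters, so the sketch of D and the one
    of D minus i are functions of the same finite product law.

    Adding an item costs no delta: at most k l items are alone in their bit, and
    by exchangeability the item i is one of them, jointly with S(D) in A, with
    probability at most (k l / n) P(S(D) in A) <= pi0 P(S(D) in A).

    Removing an item: the hash value of i is independent of S(D - i), whence
    P(S(D) in A) >= E[1 - pi(S(D - i)); S(D - i) in A], and the loss
    1 - e^eps (1 - pi(s)) is at most 2 (pi(s) - 2^-v). The bits j > v contribute
    at most 2^-v to pi(s), so the loss is at most the sum of 2 q_u over the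
    vacant bits u = (b, j) of s with j <= v, where q_u = 2^-j / k. A bit u is
    vacant in S(D - i) with probability (1 - q_u)^(n-1), and
    2 q_u (1 - q_u)^(n-1) <= (1 - q_u)^n <= exp (- q_u n) as soon as
    q_u <= 1/3; the factor 2 q_u is thus what turns the exponent n - 1 into n.
    The only exception is q_u = 1/2 (k = 1, j = 1), settled by n > k l. *)

(** * Finite product laws: linearity, exchangeability, resampling *)

Lemma big_option (R : Type) (idx : R) (op : Monoid.com_law idx) (K : finType)
    (F : option K -> R) :
  \big[op/idx]_o F o = op (F None) (\big[op/idx]_u F (Some u)).
Proof.
rewrite (bigD1 None) //=; congr (op _ _).
rewrite (reindex_omap Some id) => [|[u|]] //=.
by apply: eq_bigl => u; rewrite eqxx.
Qed.

Section ProductLaw.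
Variables (R : realFieldType) (I O : finType) (q : O -> R).
Implicit Types (c : {ffun I -> O}) (f g : {ffun I -> O} -> R).

Definition expect f : R :=
  \sum_(c : {ffun I -> O}) (\prod_i q (c i)) * f c.

Definition update c (i : I) (o : O) : {ffun I -> O} :=
  [ffun x => if x == i then o else c x].

Lemma eq_expect f g : f =1 g -> expect f = expect g.
Proof. by move=> fg; apply: eq_bigr => c _; rewrite fg. Qed.

Lemma expectD f g : expect (fun c => f c + g c) = expect f + expect g.
Proof. by rewrite -big_split; apply: eq_bigr => c _; rewrite mulrDr. Qed.

Lemma expectZ (a : R) f : expect (fun c => a * f c) = a * expect f.
Proof. by rewrite mulr_sumr; apply: eq_bigr => c _; rewrite mulrCA. Qed.

Lemma expect_sum (J : finType) (F : J -> {ffun I -> O} -> R) :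
  expect (fun c => \sum_j F j c) = \sum_j expect (F j).
Proof. by rewrite exchange_big; apply: eq_bigr => c _; rewrite mulr_sumr. Qed.

Lemma expect_prod (F : I -> O -> R) :
  expect (fun c => \prod_i F i (c i)) = \prod_i \sum_o q o * F i o.
Proof.
by rewrite bigA_distr_bigA; apply: eq_bigr => c _; rewrite -big_split.
Qed.

Lemma expect_perm (s : {perm I}) f :
  expect (fun c => f [ffun x => c (s x)]) = expect f.
Proof.
have inj : injective (fun c => [ffun x => c (s x)]).
  move=> c c' /ffunP e; apply/ffunP => x.
  by have := e (s^-1 x)%g; rewrite !ffunE permKV.
rewrite [RHS](reindex_inj inj); apply: eq_bigr => c _; congr (_ * _).
by rewrite (reindex_inj (@perm_inj _ s)); apply: eq_bigr => x _; rewrite ffunE.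
Qed.

Hypothesis q_ge0 : forall o, 0 <= q o.

Lemma le_expect f g : (forall c, f c <= g c) -> expect f <= expect g.
Proof.
by move=> fg; apply: ler_sum => c _; apply: ler_wpM2l => //; exact: prodr_ge0.
Qed.

Hypothesis q_sum1 : \sum_o q o = 1.

(* The exchange (c, o) |-> (update c i o, c i) preserves the product law. *)
Lemma expect_resample (i : I) f :
  expect f = expect (fun c => \sum_o q o * f (update c i o)).
Proof.
pose sw (p : {ffun I -> O} * O) := (update p.1 i p.2, p.1 i).
have swK : involutive sw.
  case=> c o; rewrite /sw /= !ffunE eqxx; congr (_, _).
  by apply/ffunP => x; rewrite !ffunE; case: eqP => // ->.
transitivity (\sum_(p : {ffun I -> O} * O)
    (\prod_x q (p.1 x)) * q p.2 * f p.1).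
  rewrite -(pair_bigA _ (fun c o => (\prod_x q (c x)) * q o * f c)) /=.
  apply: eq_bigr => c _.
  by rewrite -mulr_suml -mulr_sumr q_sum1 mulr1.
rewrite (reindex_inj (inv_inj swK)) /=.
rewrite -(pair_bigA _ (fun c o =>
  (\prod_x q (update c i o x)) * q (c i) * f (update c i o))) /=.
apply: eq_bigr => c _; rewrite mulr_sumr; apply: eq_bigr => o _.
rewrite mulrA; congr (_ * _).
rewrite (bigD1 i) //= [in RHS](bigD1 i) //= ffunE eqxx mulrAC [RHS]mulrAC.
congr (_ * _); first exact: mulrC.
by apply: eq_bigr => x /negPf nxi; rewrite ffunE nxi.
Qed.

End ProductLaw.

(** * Bits occupied by a set of items *)

Section Occupancy.
Variables (I K : finType).

Definition occupied (E : {set I}) (c : {ffun I -> option K}) : {set K} :=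
  [set u | [exists x in E, c x == Some u]].

Lemma occupiedP (E : {set I}) (c : {ffun I -> option K}) (u : K) :
  reflect (exists2 x, x \in E & c x = Some u) (u \in occupied E c).
Proof.
rewrite inE; apply: (iffP existsP) => [[x /andP[xE /eqP cx]]|[x xE cx]];
  by exists x; rewrite ?xE ?cx ?eqxx.
Qed.

Lemma occupiedT_update (i : I) (c : {ffun I -> option K}) (o : option K) :
  occupied [set: I] (update c i o) =
  if o is Some u then u |: occupied [set~ i] c else occupied [set~ i] c.
Proof.
have -> : (if o is Some u then u |: occupied [set~ i] c
           else occupied [set~ i] c) =
          [set u | (o == Some u) || (u \in occupied [set~ i] c)].
  case: o => [w|]; apply/setP => u; rewrite !inE //.
  by congr (_ || _); apply/eqP/eqP => [->|[]].
apply/setP => u; rewrite [RHS]inE.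
apply/occupiedP/orP => [[x _]|[/eqP ou|/occupiedP[x]]].
- rewrite ffunE; case: eqP => [_ ->|/eqP xi cx]; [by left|right].
  by apply/occupiedP; exists x; rewrite ?in_setC1.
- by exists i; rewrite ?inE // ffunE eqxx.
- by rewrite in_setC1 => xi cx; exists x; rewrite ?inE // ffunE (negPf xi).
Qed.

Lemma occupied_perm (s : {perm I}) (E : {set I}) (c : {ffun I -> option K}) :
  occupied (s @^-1: E) [ffun x => c (s x)] = occupied E c.
Proof.
apply/setP => u; apply/occupiedP/occupiedP => -[x].
  by rewrite inE ffunE => sx csx; exists (s x).
by move=> xE cx; exists (s^-1 x)%g; rewrite ?inE ?ffunE permKV.
Qed.

(* An item whose removal changes the occupied set is alone in its bit. *)
Lemma card_essential (c : {ffun I -> option K}) :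
  (#|[set i | occupied [set~ i] c != occupied [set: I] c]| <= #|K|)%N.
Proof.
set Es := [set i | _].
have alone i : i \in Es ->
    exists2 u, c i = Some u & forall x, c x = Some u -> x = i.
  rewrite inE => ne; case ci: (c i) => [u|]; last first.
    case/eqP: ne; apply/setP => w; apply/occupiedP/occupiedP => -[x xE cx];
      exists x; rewrite ?inE //.
    by apply/eqP => xi; move: cx; rewrite xi ci.
  (* Another item hitting [u] would keep it occupied after the removal of [i], which would then
     change nothing. *)
  exists u => // x cx; apply/eqP; apply: contraNT ne => xi; apply/eqP.
  apply/setP => w; apply/occupiedP/occupiedP => -[y yE cy];
    first by exists y; rewrite ?inE.
  case: (eqVneq y i) cy => [->|yi] cy; last by exists y; rewrite ?in_setC1.
  by exists x; rewrite ?in_setC1 // cx -ci.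
have inj : {in Es &, injective c}.
  by move=> i j /alone[u ci ui] /alone[w cj wj] cij; apply: wj; rewrite cij.
have someI : injective (@Some K) by move=> ? ? [].
(* Essential items have distinct values of the form [Some u], of which there are [#|K|]. *)
rewrite -(card_in_imset inj) -(card_imset _ someI).
apply/subset_leq_card/fintype.subsetP => o /imsetP[i /alone[u ci _] ->].
by rewrite ci imset_f.
Qed.

End Occupancy.

(** * Effect of one item on the law of the occupied bits *)

Section OccupancyLaw.
Variables (R : realFieldType) (I K : finType) (q : option K -> R).
Hypothesis q_ge0 : forall o, 0 <= q o.
Hypothesis q_sum1 : \sum_o q o = 1.
Implicit Types (A : pred {set K}) (c : {ffun I -> option K}).

(** All items contribute equally by exchangeability, so the left side is the expected number of
    essential items on the event [A], which [card_essential] bounds pointwise. *)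
Lemma expect_essential A (i : I) :
  #|I|%:R * expect q (fun c => (A (occupied [set: I] c) &&
               (occupied [set~ i] c != occupied [set: I] c))%:R)
  <= #|K|%:R * expect q (fun c => (A (occupied [set: I] c))%:R).
Proof.
pose F j c : R := (A (occupied [set: I] c) &&
               (occupied [set~ j] c != occupied [set: I] c))%:R.
have sym j : expect q (F j) = expect q (F i).
  rewrite -[RHS](expect_perm q (tperm i j)); apply: eq_expect => c.
  rewrite /F -(occupied_perm (tperm i j) [set: I] c) preimsetT.
  rewrite -(occupied_perm (tperm i j) [set~ j] c).
  congr ((_ && (_ != _))%:R). congr (occupied _ _).  apply/setP => x.
  by rewrite !inE -[X in _ != X](tpermL i j) (inj_eq (@perm_inj _ _)).
have -> : #|I|%:R * expect q (F i) = \sum_j expect q (F j).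
  by rewrite (eq_bigr _ (fun j _ => sym j)) sumr_const mulr_natl.
rewrite -expect_sum -expectZ; apply: le_expect => // c.
rewrite /F; case: (A _) => /=; last by rewrite mulr0 big1.
rewrite mulr1 -natr_sum ler_nat -big_mkcond /= sum1_card.
by apply: leq_trans (card_essential c); rewrite cardsE.
Qed.

(** Either the removal of [i] leaves the same set, or [i] is essential; the second case is charged
    to [expect_essential]. *)
Lemma expect_add_item A (i : I) :
  (1 - #|K|%:R / #|I|%:R) * expect q (fun c => (A (occupied [set: I] c))%:R)
  <= expect q (fun c => (A (occupied [set~ i] c))%:R).
Proof.
have I_gt0 : 0 < #|I|%:R :> R by rewrite ltr0n; apply/card_gt0P; exists i.
have := expect_essential A i; rewrite -ler_pdivlMl //.
rewrite mulrBl mul1r lerBlDr mulrAC [_ / _]mulrC => ess.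
apply: le_trans (lerD (lexx _) ess).
rewrite -expectD; apply: le_expect => // c.
case: eqVneq => [->|_]; rewrite ?andbT ?andbF ?addr0 //.
by rewrite lerDr ler0n.
Qed.

(** This is π(s) for the state [s] whose set bits are [U]: a new item changes it exactly by hitting
    a vacant bit. *)
Definition change_proba (U : {set K}) : R := \sum_(u | u \notin U) q (Some u).

(** Item [i] can be redrawn independently of the others; with probability [1 - change_proba] it hits
    no bit or an occupied one, and then both occupied sets agree. *)
Lemma expect_unchanged A (i : I) :
  expect q (fun c => (A (occupied [set~ i] c))%:R *
                     (1 - change_proba (occupied [set~ i] c)))
  <= expect q (fun c => (A (occupied [set: I] c))%:R).
Proof.
rewrite [leRHS](expect_resample q_sum1 i); apply: le_expect => // c.
set U := occupied [set~ i] c.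
have -> : 1 - change_proba U = q None + \sum_(u | u \in U) q (Some u).
  rewrite -q_sum1 big_option /change_proba (bigID (mem U)) /=.
  by rewrite addrA addrK.
rewrite big_option occupiedT_update -/U mulrDr mulrC lerD2l.
rewrite mulr_sumr [leRHS](bigID (mem U)) /=.
rewrite -[leLHS]addr0; apply: lerD; last first.
  by apply: sumr_ge0 => u _; rewrite mulr_ge0.
apply: ler_sum => u uU; rewrite occupiedT_update -/U mulrC.
by rewrite (finset.setUidPr _) // finset.sub1set.
Qed.

(** The items other than [i] avoid [u] independently, while [i] is unconstrained; hence the exponent
    [#|I|.-1]. *)
Lemma expect_vacant (i : I) (u : K) :
  expect q (fun c => (u \notin occupied [set~ i] c)%:R) =
  (1 - q (Some u)) ^+ #|I|.-1.
Proof.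
transitivity (expect q (fun c =>
    \prod_x ((x != i) ==> (c x != Some u))%:R)).
  apply: eq_expect => c.
  have -> : (u \notin occupied [set~ i] c) =
            [forall x, (x != i) ==> (c x != Some u)].
    rewrite inE negb_exists; apply: eq_forallb => x.
    by rewrite in_setC1 negb_and implybE.
  case: forallP => [all|nall]; first by rewrite big1 // => x _; rewrite all.
  have /forallP/forallPn[x nx] := nall.
  by rewrite (bigD1 x) //= (negPf nx) mul0r.
rewrite (expect_prod q (fun x o => ((x != i) ==> (o != Some u))%:R)).
rewrite (bigD1 i) //= eqxx /=.
rewrite (eq_bigr q) => [|o _]; last by rewrite mulr1.
rewrite q_sum1 mul1r.
have qu : \sum_o q o * (o != Some u)%:R = 1 - q (Some u).
  rewrite -[X in _ = X - _]q_sum1 (bigD1 (Some u)) //= eqxx mulr0 add0r.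
  rewrite [in RHS](bigD1 (Some u)) //= addrAC subrr add0r.
  by apply: eq_bigr => o ->; rewrite mulr1.
rewrite (eq_bigr (fun=> 1 - q (Some u))) => [|x ->]; last exact: qu.
by rewrite prodr_const cardC1.
Qed.

(** The loss left by [expect_unchanged] is bounded by a sum over vacant bits, so linearity reduces
    it to vacancy probabilities. Charging this bound on states outside [A] as well makes it uniform
    in [A]. *)
Lemma expect_remove_item A (i : I) (a : R) (g : K -> R) :
  0 <= a ->
  (forall u, 0 <= g u) ->
  (forall U, 1 - a * (1 - change_proba U) <= \sum_(u | u \notin U) g u) ->
  expect q (fun c => (A (occupied [set~ i] c))%:R) <=
  a * expect q (fun c => (A (occupied [set: I] c))%:R) +
  \sum_u g u * (1 - q (Some u)) ^+ #|I|.-1.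
Proof.
move=> a_ge0 g_ge0 gP.
apply: (le_trans _ (lerD (ler_wpM2l a_ge0 (expect_unchanged A i)) (lexx _))).
under [X in _ <= _ + X]eq_bigr do rewrite -(expect_vacant i) -expectZ.
rewrite -expect_sum -expectZ -expectD; apply: le_expect => // c.
set U := occupied _ c.
have -> : \sum_u g u * (u \notin U)%:R = \sum_(u | u \notin U) g u.
  rewrite [RHS]big_mkcond; apply: eq_bigr => u _.
  by case: ifP => _ /=; rewrite ?mulr1 ?mulr0.
have := gP U; have : 0 <= \sum_(u | u \notin U) g u by exact: sumr_ge0.
by case: (A U) => g0 g1; rewrite /= ?mul1r ?mul0r ?mulr0; lra.
Qed.

End OccupancyLaw.

(** * Reduction of the hashed sketch to the product law of the hit bits *)

Lemma probability_fin_valued (R : realType) (d : measure_display)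
    (T : measurableType d) (P : probability T R) (C : finType) (Y : T -> C)
    (Phi : pred C) :
  (forall c, measurable (Y @^-1` [set c])%classic) ->
  P [set r | Phi (Y r)]%classic =
  (\sum_(c | Phi c) P (Y @^-1` [set c])%classic)%E.
Proof.
move=> mY.
have -> : [set r | Phi (Y r)]%classic =
          (\bigcup_(c in [set` Phi]) (Y @^-1` [set c]))%classic.
  by apply/seteqP; split=> [r Yr|r [c /= Pc ->]] //; exists (Y r).
rewrite measure_fin_bigcup //; last by apply/trivIsetP => c c' _ _ cc';
  apply/seteqP; split=> // r [/= Yc Yc']; rewrite -Yc -Yc' eqxx in cc'.
rewrite -(bigfs _ (index_enum_uniq C)) //.
by move=> c _; rewrite mem_index_enum.
Qed.

(** [None] gathers the values [G = 0] and [G > l], which leave every state unchanged. *)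
Definition fm85_bit (k l : nat) (bg : 'I_k * nat) : option ('I_k * 'I_l) :=
  if bg.2 is j.+1 then omap (pair bg.1) (insub j) else None.

Lemma fm85_bitP (k l : nat) (bg : 'I_k * nat) (b : 'I_k) (j : 'I_l) :
  fm85_bit l bg = Some (b, j) <-> bg = (b, j.+1).
Proof.
case: bg => c [|g] /=; rewrite /fm85_bit /=; first by split.
split=> [|[-> ->]]; last by rewrite valK.
by case: insubP => //= o _ <- [-> ->].
Qed.

Definition bit_proba (R : realType) (k l : nat) (u : 'I_k * 'I_l) : R :=
  k%:R^-1 * 2 ^- u.2.+1.

Definition bit_law (R : realType) (k l : nat) (o : option ('I_k * 'I_l)) : R :=
  if o is Some u then bit_proba R u else
    1 - \sum_(u : 'I_k * 'I_l) bit_proba R u.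

Section HashLaw.
Variables (R : realType) (d : measure_display) (T : measurableType d).
Variables (P : probability T R) (X : choiceType) (k l : nat).
Variable h : X -> T -> 'I_k * nat.
Hypothesis hash : fm85_hash P h.
Implicit Types (x : X) (o : option ('I_k * 'I_l)).

Let bit x r := fm85_bit l (h x r).

Lemma measurable_bit x o : measurable (bit x @^-1` [set o])%classic.
Proof.
exact: (fm85_hash_measurable hash x (fm85_bit l @^-1` [set o])%classic).
Qed.

Lemma proba_bit x o : P (bit x @^-1` [set o])%classic = (bit_law R o)%:E.
Proof.
have some u : P (bit x @^-1` [set Some u])%classic = (bit_proba R u)%:E.
  case: u => b j.
  have -> : (bit x @^-1` [set Some (b, j)] =
     [set r | (h x r).1 = b] `&` [set r | (h x r).2 = j.+1])%classic.
    apply/seteqP; split=> r /=; rewrite /bit.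
      by move=> /fm85_bitP ->.
    by case=> e1 e2; apply/fm85_bitP; rewrite -e1 -e2; case: (h x r).
  by rewrite (fm85_hash_BG_indep hash) (fm85_hash_B hash) (fm85_hash_G hash).
case: o => [u|]; first exact: some.
(* The mass at [None] is what the bits leave of the total mass 1; its finiteness allows the
   subtraction in the extended reals. *)
have := probability_fin_valued P predT (measurable_bit x).
have -> : [set r | predT (bit x r)]%classic = setT by apply/seteqP; split.
rewrite probability_setT big_option /= (eq_bigr _ (fun u _ => some u)) sumEFin.
move=> e; have : P (bit x @^-1` [set None])%classic \is a fin_num.
  by rewrite fin_num_measure //; exact: measurable_bit.
by move: e; case: (P _) => // r /= [->] _; rewrite addrK.
Qed.

(** The value at [None] is a difference; its sign comes from being the probability of an event about
    some item [x]. *)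
Lemma bit_law_ge0 x o : 0 <= bit_law R o.
Proof. by rewrite -lee_fin -(proba_bit x). Qed.

Lemma bit_law_sum1 : \sum_(o : option ('I_k * 'I_l)) bit_law R o = 1.
Proof. by rewrite big_option /= subrK. Qed.

Variable D : {fset X}.

Definition bits (r : T) : {ffun D -> option ('I_k * 'I_l)} :=
  [ffun x => bit (val x) r].

(** Independence is stated for families of sets indexed by all of [X], so the constraints given by
    [c] are extended outside [D] by the full set. *)
Let fiber (c : {ffun D -> option ('I_k * 'I_l)}) (x : X) : set ('I_k * nat) :=
  if insub x is Some y then (fm85_bit l @^-1` [set c y])%classic else setT.

Let bits_fiber c :
  (bits @^-1` [set c] = \bigcap_(x in [set` D]) h x @^-1` fiber c x)%classic.
Proof.
apply/seteqP; split=> r /=.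
  move=> <- x /= xD; rewrite /fiber insubT /= ffunE //.
move=> hr; apply/ffunP => y; rewrite ffunE.
have := hr (val y) (valP y); rewrite /fiber /=.
by rewrite valK.
Qed.

Lemma measurable_bits c : measurable (bits @^-1` [set c])%classic.
Proof.
rewrite bits_fiber; apply: fin_bigcap_measurable; first exact: finite_fset.
by move=> x _; exact: (fm85_hash_measurable hash).
Qed.

Lemma proba_bits (Phi : pred {ffun D -> option ('I_k * 'I_l)}) :
  P [set r | Phi (bits r)]%classic =
  (expect (@bit_law R k l) (fun c => (Phi c)%:R))%:E.
Proof.
rewrite (probability_fin_valued P Phi measurable_bits) /expect -sumEFin.
rewrite big_mkcond; apply: eq_bigr => c _; case: (Phi c); last by rewrite mulr0.
rewrite mulr1 bits_fiber (fm85_hash_indep hash) -prodEFin big_seq_fsetE.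
apply: eq_bigr => y _; rewrite /fiber valK.
exact: (proba_bit (val y) (c y)).
Qed.

Definition state_of (U : {set 'I_k * 'I_l}) : fm85_state k l :=
  \matrix_(b, j) ((b, j) \in U).

(** This couples the sketches of [D] and of [D] minus an item: both are read off the same assignment
    [bits]. *)
Lemma fm85_sketch_sub (E : {fset X}) (r : T) : (E `<=` D)%fset ->
  fm85_sketch l h E r =
  state_of (occupied [set x | val x \in E] (bits r)).
Proof.
move=> /fsubsetP ED; apply/matrixP => b j; rewrite fm85_runE mxE.
apply/hasP/occupiedP => [[x xE /eqP hx]|[y]].
  exists [` ED x xE]%fset; first by rewrite inE.
  by rewrite ffunE; apply/fm85_bitP.
rewrite inE ffunE => yE /fm85_bitP hy; exists (val y) => //.
by apply/eqP.
Qed.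

Lemma proba_fm85_sketch (A : set (fm85_state k l)) :
  P (fm85_sketch l h D @^-1` A)%classic =
  (expect (@bit_law R k l)
    (fun c => (`[< A (state_of (occupied [set: D] c)) >])%:R))%:E.
Proof.
rewrite -(proba_bits (fun c => `[< A (state_of (occupied [set: D] c)) >])).
congr (P _); apply/seteqP.
have DT : [set x : D | val x \in D] = [set: D].
  by apply/setP => x; rewrite !inE (valP x).
by split=> r /=; rewrite fm85_sketch_sub // DT => /asboolP.
Qed.

Lemma proba_fm85_sketchD1 (A : set (fm85_state k l)) (i : D) :
  P (fm85_sketch l h (D `\ val i)%fset @^-1` A)%classic =
  (expect (@bit_law R k l)
    (fun c => (`[< A (state_of (occupied [set~ i] c)) >])%:R))%:E.
Proof.
rewrite -(proba_bits (fun c => `[< A (state_of (occupied [set~ i] c)) >])).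
congr (P _); apply/seteqP.
have Di : [set x : D | val x \in (D `\ val i)%fset] = [set~ i].
  by apply/setP => x; rewrite !inE (valP x) andbT.
by split=> r /=; rewrite fm85_sketch_sub ?fsubD1set // Di => /asboolP.
Qed.

End HashLaw.

(** * Geometric bit probabilities and the probability of a change *)

(** The [maxn] covers [l <= m], where the sum is empty and the difference vanishes. *)
Lemma sum_half_powers (R : numFieldType) (l m : nat) :
  \sum_(j < l | (m <= j)%N) 2 ^- j.+1 = 2 ^- m - 2 ^- maxn m l :> R.
Proof.
elim: l => [|l IH]; first by rewrite big_ord0 maxn0 subrr.
rewrite big_mkcond big_ord_recr /= -big_mkcond /= IH.
have [ml|lm] := leqP m l.
  rewrite (maxn_idPr (leqW ml)).
  have -> : 2 ^- l = 2 * 2 ^- l.+1 :> R.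
    by rewrite exprS invfM mulrA divff ?mul1r // pnatr_eq0.
  by ring.
by rewrite (maxn_idPl lm) addr0.
Qed.

Section BitProba.
Variables (R : realType) (k l : nat).
Hypothesis k_gt0 : (0 < k)%N.
Implicit Types (u : 'I_k * 'I_l) (U : {set 'I_k * 'I_l}).

Lemma bit_proba_ge0 u : 0 <= bit_proba R u.
Proof. by rewrite mulr_ge0 ?invr_ge0 ?exprn_ge0. Qed.

Lemma sum_bit_proba (m : nat) :
  \sum_(u : 'I_k * 'I_l | (m <= u.2)%N) bit_proba R u = 2 ^- m - 2 ^- maxn m l.
Proof.
rewrite -(pair_big xpredT (fun j : 'I_l => (m <= j)%N)
  (fun b j => bit_proba R (b, j))) /=.
rewrite /bit_proba; under eq_bigr do rewrite -mulr_sumr sum_half_powers.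
rewrite sumr_const card_ord -[LHS]mulr_natl mulrA divff ?mul1r // pnatr_eq0.
by rewrite -lt0n.
Qed.

Lemma change_probaE U : change_proba (@bit_law R k l) U =
  \sum_(u | u \notin U) bit_proba R u.
Proof. by []. Qed.

(** The values [G > l] have total probability [2 ^- l] and never change the state. *)
Lemma change_proba_le U : change_proba (@bit_law R k l) U <= 1 - 2 ^- l.
Proof.
have := sum_bit_proba 0; rewrite expr0 invr1 max0n => <-.
rewrite change_probaE big_mkcond; apply: ler_sum => u _ /=.
by case: ifP => // _; exact: bit_proba_ge0.
Qed.

(** Columns count from 0, so [u.2 < m] selects the bits numbered 1 to [m]; the later ones have total
    mass at most [2 ^- m]. *)
Lemma change_proba_le_low U (m : nat) :
  change_proba (@bit_law R k l) U <=
  2 ^- m + \sum_(u | (u \notin U) && (u.2 < m)%N) bit_proba R u.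
Proof.
rewrite change_probaE (bigID (fun u => (u.2 < m)%N)) /= addrC.
apply: lerD => //.
apply: (@le_trans _ _ (\sum_(u : 'I_k * 'I_l | (m <= u.2)%N) bit_proba R u)).
  rewrite big_mkcond [leRHS]big_mkcond; apply: ler_sum => u _.
  rewrite -leqNgt; case: (u \notin U) => //=.
  by case: ifP => // _; exact: bit_proba_ge0.
by rewrite sum_bit_proba gerBl invr_ge0 exprn_ge0.
Qed.

(* When [k = m = 1] and [l <= 2], the estimate [tail_coef_le] would fail for
   [n = l + 1] with the coefficient [2 * bit_proba R u = 1]. *)
Definition tail_coef (m : nat) u : R :=
  if (u.2 < m)%N then
    if [&& k == 1%N, m == 1%N & (l <= 2)%N] then 2^-1 else 2 * bit_proba R u
  else 0.

Lemma tail_coef_ge0 m u : 0 <= tail_coef m u.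
Proof.
rewrite /tail_coef; do 2 case: ifP => // _.
by rewrite mulr_ge0 ?bit_proba_ge0.
Qed.

Lemma change_excess_le (m : nat) (a : R) U :
  (0 < m)%N -> 1 <= a * (1 - 2 ^- m) ->
  1 - a * (1 - change_proba (@bit_law R k l) U) <=
  \sum_(u | u \notin U) tail_coef m u.
Proof.
move=> m_gt0 a1.
have g_ge0 : 0 <= \sum_(u | u \notin U) tail_coef m u.
  by apply: sumr_ge0 => u _; exact: tail_coef_ge0.
have t_half : 2 ^- m <= 2^-1 :> R.
  by rewrite lef_pV2 ?posrE ?exprn_gt0 // -[leLHS]expr1 ler_eXn2l // ltr1n.
have := change_proba_le U; have := change_proba_le_low U m.
set s := change_proba _ _; set t := 2 ^- m in a1 t_half *; move=> s_low s_le.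
have l_gt0 : 0 < 2 ^- l :> R by rewrite invr_gt0 exprn_gt0.
(* For [s <= t] the left side is nonpositive, since [a * (1 - t)] is already at least 1. *)
have [st|ts] := leP s t.
  suff: a * (1 - t) <= a * (1 - s) by lra.
  by apply: ler_wpM2l; nra.
(* Since [a >= 1 / (1 - t)], the loss is at most [(s - t) / (1 - t)]; the factor 2 comes from
   [t <= 1/2]. *)
have le2 : 1 - a * (1 - s) <= 2 * (s - t).
  suff: (1 - 2 * (s - t)) <= a * (1 - s) by lra.
  have a_ge0 : 0 <= a by nra.
  nra.
apply: le_trans le2 _; case: (boolP [&& k == 1%N, m == 1%N & (l <= 2)%N]) => sp.
  have [/existsP[u /andP[uU um]]|none] :=
      boolP [exists u : 'I_k * 'I_l, (u \notin U) && (u.2 < m)%N].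
    rewrite (bigD1 u) //= {1}/tail_coef um sp.
    have : 0 <= \sum_(i | (i \notin U) && (i != u)) tail_coef m i.
      by apply: sumr_ge0 => i _; exact: tail_coef_ge0.
    (* Here [s <= 1 - 2 ^- l <= 3/4] and [t = 1/2], so [2 * (s - t) <= 1/2], the coefficient of the
       vacant bit [u]. *)
    have : 4^-1 <= 2 ^- l :> R.
      case/and3P: sp => _ _ l2; rewrite (_ : 4 = 2 ^+ 2 :> R); last by ring.
      by rewrite lef_pV2 ?posrE ?exprn_gt0 // ler_eXn2l // ltr1n.
    have : t = 2^-1 by case/and3P: sp => _ /eqP mE _; rewrite /t mE expr1.
    by lra.
  (* Without a vacant low bit, [s <= t], against [ts]. *)
  move: s_low; rewrite big_pred0; first by lra.
  by move=> u; apply: contraNF none => uP; apply/existsP; exists u.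
have -> : \sum_(u | u \notin U) tail_coef m u =
          2 * \sum_(u | (u \notin U) && (u.2 < m)%N) bit_proba R u.
  rewrite mulr_sumr big_mkcondr; apply: eq_bigr => u _.
  by rewrite /tail_coef (negPf sp).
by lra.
Qed.

End BitProba.

(** * Exponential bounds on the vacancy terms *)

(** Serves the bit of probability 1/2 when [m >= 2]. The missing power of 1/2 is absorbed by two
    factors, as [(3/4)^2 >= 1/2]. *)
Lemma half_powers_le_expR_quarter (R : realType) (n : nat) : (1 < n)%N ->
  2 ^- n.-1 <= expR (- 4^-1) ^+ n :> R.
Proof.
case: n => [|[|n]] // _; rewrite /= -exprVn exprSr -(addn2 n) exprD.
have e4 : 1 - 4^-1 <= expR (- 4^-1) :> R by rewrite expR_ge1Dx.
apply: ler_pM; rewrite ?invr_ge0 ?exprn_ge0 //; last by nra.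
by rewrite lerXn2r ?nnegrE ?invr_ge0 ?expR_ge0 //; lra.
Qed.

(** Serves the bit of probability 1/2 when [m = 1] and [l >= 3]. The core is [1/8 <= exp (-2)], the
    case [n = 4]; the inequality fails at [n = 3]. *)
Lemma half_powers_le_expR_half (R : realType) (n : nat) : (3 < n)%N ->
  2 ^- n.-1 <= expR (- 2^-1) ^+ n :> R.
Proof.
case: n => [|[|[|[|n]]]] // _; rewrite /= -exprVn -(addn4 n) -(addn3 n) !exprD.
have sq (x a b : R) : 0 <= a -> b <= a ^+ 2 -> a <= expR (x / 2) -> b <= expR x.
  move=> a_ge0 ba ax; apply: le_trans ba _.
  rewrite (_ : x = 2%:R * (x / 2)) ?expRM_natl ?lerXn2r ?nnegrE ?expR_ge0 //.
  by rewrite mulrCA divff ?mulr1.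
(* The tangent bound at -1/2 is too weak, so it is applied at -1/32 and squared four times, rounding
   down to small fractions; [(25/42)^4] still exceeds 1/8. *)
have e16 : 31 / 32 <= expR (- 2^-1 / 2 / 2 / 2 / 2) :> R.
  by apply: le_trans (expR_ge1Dx _); lra.
have e8 : 61 / 65 <= expR (- 2^-1 / 2 / 2 / 2) :> R by apply: sq e16; lra.
have e4 : 22 / 25 <= expR (- 2^-1 / 2 / 2) :> R by apply: sq e8; lra.
have e2 : 24 / 31 <= expR (- 2^-1 / 2) :> R by apply: sq e4; lra.
have e1 : 25 / 42 <= expR (- 2^-1) :> R by apply: sq e2; lra.
apply: ler_pM; rewrite ?invr_ge0 ?exprn_ge0 //.
  by rewrite lerXn2r ?nnegrE ?invr_ge0 ?expR_ge0 //; lra.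
apply: (@le_trans _ _ ((25 / 42) ^+ 4)); first by lra.
by apply: lerXn2r e1; rewrite nnegrE ?expR_ge0 //; lra.
Qed.

Lemma expr1B_le_expR (R : realType) (x : R) (n : nat) : 0 <= x <= 1 ->
  (1 - x) ^+ n <= expR (- (x * n%:R)).
Proof.
move=> /andP[x0 x1]; rewrite -mulNr expRM_natr.
by apply: lerXn2r; rewrite ?nnegrE ?expR_ge0 ?subr_ge0 ?expR_ge1Dx.
Qed.

Section Tail.
Variables (R : realType) (k l m n : nat).
Hypothesis k_gt0 : (0 < k)%N.
Hypothesis m_gt0 : (0 < m)%N.
Implicit Types (u : 'I_k * 'I_l).

Lemma tail_coef_le u : (k * l < n)%N -> (u.2 < m)%N ->
  tail_coef R m u * (1 - bit_proba R u) ^+ n.-1 <=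
  expR (- (2 ^- m * n%:R / k%:R)).
Proof.
move=> kln um; rewrite /tail_coef um.
have n_gt0 : (0 < n)%N by apply: leq_trans kln.
have l_gt0 : (0 < l)%N by apply: leq_trans (ltn_ord u.2).
have q_ge : k%:R^-1 * 2 ^- m <= bit_proba R u.
  apply: ler_wpM2l; rewrite ?invr_ge0 //.
  by rewrite lef_pV2 ?posrE ?exprn_gt0 // ler_eXn2l ?ltr1n.
have q_ge0 : 0 <= bit_proba R u := bit_proba_ge0 _ _.
have main : bit_proba R u <= 2^-1 ->
    (1 - bit_proba R u) ^+ n <= expR (- (2 ^- m * n%:R / k%:R)).
  move=> q_le; apply: le_trans (expr1B_le_expR _ _) _; first by lra.
  rewrite ler_expR lerN2 mulrAC [_ / k%:R]mulrC.
  by apply: ler_wpM2r.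
have [/andP[/eqP k1 /eqP j0]|nk1j0] :=
    boolP ((k == 1%N) && (u.2 == 0%N :> nat)).
  have kR1 : k%:R = 1 :> R by rewrite k1.
  have qE : bit_proba R u = 2^-1 by rewrite /bit_proba kR1 j0 invr1 mul1r expr1.
  case: ifP => [_|/negbT sp].
    (* The coefficient 1/2 equals [1 - bit_proba R u] and supplies the missing power. *)
    apply: le_trans (main _); last by rewrite qE.
    have -> : 2^-1 = 1 - bit_proba R u by rewrite qE; lra.
    by rewrite -exprS prednK.
  rewrite qE divff // mul1r (_ : 1 - 2^-1 = 2^-1); last by lra.
  rewrite exprVn kR1 divr1 -mulNr expRM_natr.
  (* If [m = 1] then [l >= 3], so [n > l] gives [n >= 4]; if [m >= 2], [n > l >= 1] gives
     [n >= 2]. *)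
  move: m_gt0 sp; rewrite k1 eqxx leq_eqVlt /= => /orP[/eqP <-|m1].
    rewrite eqxx /= -ltnNge expr1 => l2; apply: half_powers_le_expR_half.
    by move: kln; rewrite k1 mul1n; apply: leq_ltn_trans.
  move=> _; apply: (@le_trans _ _ (expR (- 4^-1) ^+ n)).
    apply: half_powers_le_expR_quarter.
    by move: kln; rewrite k1 mul1n; apply: leq_ltn_trans.
  apply: lerXn2r; rewrite ?nnegrE ?expR_ge0 // ler_expR lerN2.
  rewrite (_ : 4 = 2 ^+ 2 :> R); last by ring.
  by rewrite lef_pV2 ?posrE ?exprn_gt0 // ler_eXn2l // ltr1n.
(* Either [k >= 2] or the column is not the first, and each contributes a further factor 1/2. *)
have q_le : bit_proba R u <= 4^-1.
  rewrite /bit_proba -invfM lef_pV2 ?posrE ?mulr_gt0 ?exprn_gt0 ?ltr0n //.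
  rewrite -natrX -natrM ler_nat expnS.
  have : (0 < 2 ^ u.2)%N by rewrite expn_gt0.
  move: nk1j0; rewrite negb_and => /orP[k1|]; first by move: k_gt0 k1; nia.
  case: (nat_of_ord u.2) => // j _; rewrite expnS; move: k_gt0.
  have : (0 < 2 ^ j)%N by rewrite expn_gt0.
  by nia.
case: ifP => [/and3P[k1 /eqP m1 _]|_].
  by move: nk1j0 um; rewrite k1 m1 ltnS leqn0 /= => /negPf ->.
apply: le_trans (main _); last by lra.
(* From [q <= 1/4] follows [2 * q <= 1 - q], which raises the exponent to [n]. *)
rewrite -[in leRHS](prednK n_gt0) exprS; apply: ler_wpM2r; last by lra.
by rewrite exprn_ge0 //; lra.
Qed.

Lemma card_low_bits : (#|[pred u : 'I_k * 'I_l | (u.2 < m)%N]| <= k * m)%N.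
Proof.
rewrite -sum1_card.
rewrite -(pair_big xpredT (fun j : 'I_l => (j < m)%N) (fun _ _ => 1%N)).
rewrite sum_nat_const card_ord leq_mul2l; apply/orP; right.
have [lm|/ltnW ml] := leqP l m.
  by apply: leq_trans lm; rewrite sum1_card -[leqRHS](card_ord l) max_card.
by rewrite (big_ord_narrow ml) sum1_card card_ord.
Qed.

(** Each of the at most [k * m] low bits costs one exponential. The guard on [k * l < n] covers
    [l = 0], where the sum is empty and [n] may be 0. *)
Lemma sum_tail_coef_le : ((0 < k * l)%N -> (k * l < n)%N) ->
  \sum_(u : 'I_k * 'I_l) tail_coef R m u * (1 - bit_proba R u) ^+ n.-1 <=
  k%:R * m%:R * expR (- (2 ^- m * n%:R / k%:R)).
Proof.
move=> kln; set e := expR _.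
apply: (@le_trans _ _ (\sum_(u : 'I_k * 'I_l | (u.2 < m)%N) e)).
  rewrite [leRHS]big_mkcond; apply: ler_sum => u _.
  case: ifP => um; last by rewrite /tail_coef um mul0r.
  apply: tail_coef_le => //; apply: kln; rewrite muln_gt0 k_gt0.
  exact: leq_trans (ltn_ord u.2).
rewrite sumr_const -[leLHS]mulr_natl -natrM ler_wpM2r ?expR_ge0 // ler_nat.
exact: card_low_bits.
Qed.

End Tail.

(** * The dyadic approximation of [pi0] and the privacy guarantee *)

(** The bounds of the ceiling, multiplied by [ln 2], are exponentiated. As [x < 1], the ceiling is
    at least 1, which later gives [2 ^- m <= 1/2]. *)
Lemma ceil_log2_itv (R : realType) (x : R) : 0 < x < 1 ->
  exists2 m : nat, (0 < m)%N &
    Num.ceil (- (ln x / ln 2)) = m%:Z /\ x / 2 < 2 ^- m <= x.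
Proof.
move=> /andP[x_gt0 x_lt1].
have ln2_gt0 : 0 < ln 2 :> R by rewrite ln_gt0 // ltr1n.
have lnx_lt0 : ln x < 0 by rewrite ln_lt0 // x_gt0.
have y_gt0 : 0 < - (ln x / ln 2) by rewrite -mulNr divr_gt0 // oppr_gt0.
have := ceil_itv (- (ln x / ln 2)).
have : 0 < Num.ceil (- (ln x / ln 2)) by rewrite ceil_gt0.
case: (Num.ceil _) => // m m_gt0; rewrite intrD -mulNr => /andP[].
rewrite ltr_pdivlMr // ler_pdivrMr // => lo hi; exists m => //; split=> //.
have two_m : 2 ^- m = expR (- (m%:R * ln 2)) :> R.
  by rewrite expRN expRM_natl lnK ?posrE.
rewrite two_m -[x]lnK ?posrE // -{1}[2]lnK ?posrE // -expRN -expRD.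
rewrite ltr_expR ler_expR; move: lo hi; rewrite -!pmulrn.
by move=> lo hi; apply/andP; split; lra.
Qed.

Lemma fm85_sketch_DP (R : realType) (d : measure_display)
    (T : measurableType d) (P : probability T R) (X : choiceType) (k l : nat)
    (h : X -> T -> 'I_k * nat) (eps : R) (n : nat) (g : 'I_k * 'I_l -> R) :
  fm85_hash P h -> 0 <= eps ->
  (k * l)%:R <= n%:R * (1 - expR (- eps)) ->
  (forall u, 0 <= g u) ->
  (forall U, 1 - expR eps * (1 - change_proba (@bit_law R k l) U) <=
             \sum_(u | u \notin U) g u) ->
  sketch_DP P (fm85_sketch l h) n eps
    (\sum_u g u * (1 - bit_proba R u) ^+ n.-1).
Proof.
move=> hash eps_ge0 n_ge g_ge0 gP D x cardD xD A.
pose i : D := [` xD]%fset.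
have q_ge0 := @bit_law_ge0 R d T P X k l h hash x.
have q_sum1 := @bit_law_sum1 R k l.
have cardI : #|{: D}| = n by rewrite -cardfE.
rewrite (proba_fm85_sketch hash) (_ : x = val i) // (proba_fm85_sketchD1 hash).
rewrite -!EFinM -!EFinD !lee_fin.
set A' : pred {set 'I_k * 'I_l} := fun U => `[< A (state_of U) >].
have := expect_remove_item q_ge0 q_sum1 A' i (expR_ge0 eps) g_ge0 gP.
have := expect_add_item q_ge0 A' i.
rewrite cardI card_prod !card_ord /=.
set pD := expect _ _; set pDi := expect _ _ => add rem; split=> //.
have pD_ge0 : 0 <= pD.
  by apply: sumr_ge0 => c _; rewrite mulr_ge0 ?ler0n // prodr_ge0.
have n_gt0 : 0 < n%:R :> R.
  by rewrite ltr0n -cardI; apply/card_gt0P; exists i.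
have frac : (k * l)%:R / n%:R <= 1 - expR (- eps).
  by rewrite ler_pdivrMr // mulrC.
(* The factor [1 - k * l / n] of [expect_add_item] is at least [expR (- eps)], so this direction
   uses no delta. *)
have bound : expR (- eps) * pD <= pDi.
  by apply: le_trans add; apply: ler_wpM2r => //; lra.
have d_ge0 : 0 <= \sum_u g u * (1 - bit_proba R u) ^+ n.-1.
  apply: sumr_ge0 => u _; rewrite mulr_ge0 // exprn_ge0 // subr_ge0.
  rewrite -(bit_law_sum1 R k l) (bigD1 (Some u)) //= lerDl.
  exact: sumr_ge0.
apply: le_trans (_ : expR eps * pDi <= _); last by rewrite lerDl.
by rewrite -ler_pdivrMl ?expR_gt0 // -expRN.
Qed.

Theorem theorem6 (R : realType) (d : measure_display) (T : measurableType d)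
    (P : probability T R) (X : choiceType) (k l : nat)
    (h : X -> T -> 'I_k * nat) (eps : R) (n : nat)
    (k_gt0 : (0 < k)%N) (hash : fm85_hash P h) (eps_gt0 : 0 < eps) :
  let pi0 : R := 1 - expR (- eps) in
  let n0 : R := (k%:R * l%:R) / (1 - expR (- eps)) in
  let v : int := Num.ceil (- (ln pi0 / ln 2)) in
  let tpi0 : R := 2 ^ (- v) in
  pi0 / 2 < tpi0 <= pi0 /\
  (n0 <= n%:R ->
   exists delta : R,
     [/\ 0 <= delta,
         delta <= k%:R * v%:~R * expR (- (tpi0 * n%:R / k%:R)) &
         sketch_DP P (fm85_sketch l h) n eps delta]).
Proof.
move=> pi0 n0 v tpi0.
have e_gt0 : 0 < expR (- eps) by exact: expR_gt0.
have e_lt1 : expR (- eps) < 1 by rewrite -expR0 ltr_expR oppr_lt0.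
have pi0_itv : 0 < pi0 < 1 by rewrite /pi0; apply/andP; split; lra.
have [m m_gt0 [vE m_itv]] := ceil_log2_itv pi0_itv.
have vm : v = m%:Z := vE.
have tE : tpi0 = 2 ^- m by rewrite /tpi0 vm exprnN.
rewrite tE vm; split=> // n_ge.
have kl_le : (k * l)%:R <= n%:R * pi0.
  by rewrite natrM -ler_pdivrMr //; case/andP: pi0_itv.
exists (\sum_(u : 'I_k * 'I_l) tail_coef R m u * (1 - bit_proba R u) ^+ n.-1).
split.
- apply: sumr_ge0 => u _; rewrite mulr_ge0 ?tail_coef_ge0 // exprn_ge0 //.
  rewrite subr_ge0 /bit_proba -invfM invf_le1; last first.
    by rewrite mulr_gt0 ?ltr0n ?exprn_gt0.
  by rewrite -natrX -natrM ler1n muln_gt0 k_gt0 expn_gt0.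
(* Strictness comes from [pi0 < 1]: [0 < k * l <= n * pi0] forces [k * l < n]. *)
- apply: sum_tail_coef_le => // kl_gt0; rewrite -(ltr_nat R).
  move: kl_le kl_gt0; rewrite -(ltr_nat R); move: pi0_itv => /andP[p0 p1].
  set N : R := n%:R; have : 0 <= N by rewrite ler0n.
  by nra.
- apply: fm85_sketch_DP => // [|u|U]; [exact: ltW|exact: tail_coef_ge0|].
  apply: change_excess_le => //.
  move: m_itv => /andP[_ m_le].
  (* The bound [2 ^- m <= pi0] says that [1 - 2 ^- m] is at least [expR (- eps)]. *)
  have {1}<- : expR eps * expR (- eps) = 1 by rewrite -expRD subrr expR0.
  by rewrite ler_pM2l ?expR_gt0 //; move: m_le; rewrite /pi0; lra.
Qed.
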